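(* Let $K$ be a compact group with an irreducible unitary representation on a finite-dimensional complex vector space $V$. If $V$ is transversal then $\mathsf{C}(V) = 1$.
   Context: Let a group $H$ act linearly on a finite-dimensional complex vector space $V$. The representation $V$ is called transversal if for every pair of subspaces $W, U \leq V$ there is some $g \in H$ with $$\dim(W \cap g\cdot U) = \max(0, \dim W + \dim U - \dim V).$$ For a nonzero subspace $U \leq V$, the group-additive diameter is $$\mathrm{diam}_+^{H}(V,U) = \min\{ m \mid g_1\cdot U + \dots + g_m\cdot U = V \text{ for some } g_1,\dots,g_m \in H\}.$$ If $H$ acts irreducibly on $V$, put $\mathsf{R}(V,U) = \mathrm{diam}_+^{H}(V,U) / \lceil \dim V/\dim U\rceil$, and the covering complexity of $V$ (with respect to $H$) is $\mathsf{C}(V) = \max_{0 \neq U \leq V} \mathsf{R}(V,U)$. In the claim $H = K$. Representations of compact groups are continuous. *)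

(* Defs.v *)
From HB Require Import structures.
From mathcomp Require Import all_boot all_order all_algebra.
From mathcomp Require Import all_classical all_reals all_analysis.
From mathcomp Require Import complex.

Set Implicit Arguments.
Unset Strict Implicit.
Unset Printing Implicit Defensive.

Import Order.TTheory GRing.Theory Num.Theory.
Import numFieldNormedType.Exports.

Local Open Scope classical_set_scope.
Local Open Scope ring_scope.

HB.mixin Record Group_isTopologicalGroup G & Topological G & Group G := {
  mulg_continuous : continuous (fun x : G * G => (x.1 * x.2)%g) ;
  invg_continuous : continuous (fun x : G => (x^-1)%g)
}.

#[short(type="topologicalGroupType")]
HB.structure Definition TopologicalGroup :=
  {G of Group_isTopologicalGroup G & Topological G & Group G}.

Section LinearAction.
Variables (F : fieldType) (V : vectType F) (H : groupType).

Definition is_linear_action (rho : H -> 'End(V)) : Prop :=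
  rho 1%g = \1%VF /\ forall g h : H, rho (g * h)%g = (rho g \o rho h)%VF.

Variable rho : H -> 'End(V).

Definition irreducible_action : Prop :=
  fullv <> 0%VS :> {vspace V} /\
  forall U : {vspace V}, (forall g : H, (rho g @: U <= U)%VS) ->
    U = 0%VS \/ U = fullv.

(* Subtraction on nat is truncated at 0, hence the max with 0. *)
Definition transversal_action : Prop :=
  forall W U : {vspace V}, exists g : H,
    \dim (W :&: rho g @: U)%VS = (\dim W + \dim U - \dim {:V})%N.

Definition translates_span (U : {vspace V}) (m : nat) : Prop :=
  exists g : 'I_m -> H, (\sum_(i < m) rho (g i) @: U)%VS = fullv.

(* The junk value 0 (no number of translates of U spans V) does not arise for
   an irreducible action and U <> 0, see [diam_plusP]. *)
Definition diam_plus (U : {vspace V}) : nat :=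
  xget 0%N [set m | translates_span U m /\
                    forall m', translates_span U m' -> (m <= m')%N].

Definition covering_ratio (U : {vspace V}) : rat :=
  (diam_plus U)%:R / (Num.ceil ((\dim {:V})%:R / (\dim U)%:R : rat))%:~R.

(* The junk value 0 is taken when the set of ratios has no maximum. *)
Definition covering_complexity : rat :=
  xget 0 [set c | (exists2 U : {vspace V}, U <> 0%VS & covering_ratio U = c) /\
                  forall U : {vspace V}, U <> 0%VS -> covering_ratio U <= c].

Lemma diam_plusP (U : {vspace V}) :
    is_linear_action rho -> irreducible_action -> U <> 0%VS ->
  translates_span U (diam_plus U) /\
  forall m, translates_span U m -> (diam_plus U <= m)%N.
Proof.
move=> [rho1 rhoM] [_ irr] U0; rewrite /diam_plus.
apply: (@xgetPex _ 0%N [set m | translates_span U m /\ _]).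
suff [m spm] : exists m, translates_span U m.
  have ex : exists m, `[< translates_span U m >] by exists m; apply/asboolP.
  case: (ex_minnP ex) => n /asboolP spn minn; exists n; split=> // k spk.
  by apply: minn; apply/asboolP.
pose S (s : seq H) : {vspace V} := (\sum_(g <- s) rho g @: U)%VS.
have exd : exists d, `[< exists s, \dim (S s) = d >].
  by exists (\dim (S [::])); apply/asboolP; exists [::].
have led d : `[< exists s, \dim (S s) = d >] -> (d <= \dim {:V})%N.
  by move=> /asboolP[s <-]; exact/dimvS/subvf.
case: (ex_maxnP exd led) => _ /asboolP[s <-] maxs.
have absorb g : (rho g @: U <= S s)%VS.
  have sub : (S s <= S (g :: s))%VS by rewrite /S big_cons addvSr.
  have /eqP -> : S s == S (g :: s).
    rewrite eqEdim sub maxs//; apply/asboolP; by exists (g :: s).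
  by rewrite /S big_cons addvSl.
have inv g : (rho g @: S s <= S s)%VS.
  rewrite {1}/S; elim: {1}s => [|k r IHr]; first by rewrite big_nil limg0 sub0v.
  by rewrite big_cons limgD subv_add IHr andbT -limg_comp -rhoM absorb.
have [Ss0|SsV] := irr _ inv.
  by case: U0; apply/eqP; rewrite -subv0 -Ss0 -[U]lim1g -rho1 absorb.
exists (size s), (fun i => nth 1%g s i).
by rewrite -SsV /S (big_nth 1%g) big_mkord.
Qed.

End LinearAction.

Section UnitaryRepresentation.
Variables (R : realType) (V : vectType R[i]).

(* rho g is viewed as a matrix in a basis of V, i.e. as a point of the
   normed space of n x n complex matrices. *)
Definition continuous_action (K : topologicalGroupType) (rho : K -> 'End(V)) :
    Prop :=
  continuous (fun g : K =>
    passmx.mxof (vbasis {:V}) (vbasis {:V}) (rho g) : 'M[R[i]^o]_(\dim {:V})).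

Definition unitary_action (H : groupType) (dot : {dot V for Num.conj})
    (rho : H -> 'End(V)) : Prop :=
  forall (g : H) (u v : V), dot (rho g u) (rho g v) = dot u v.

End UnitaryRepresentation.

(* Main.v *)
Require Import Defs.
From HB Require Import structures.
From mathcomp Require Import all_boot all_order all_algebra.
From mathcomp Require Import all_classical all_reals all_analysis.
From mathcomp Require Import complex.
From mathcomp Require Import zify.

(** Every ratio [covering_ratio rho U] with [U <> 0] equals 1, so their maximum
    is 1.  Write [n = \dim V] and [d = \dim U].  If [W] is the sum of the
    translates chosen so far, transversality supplies a translate of [U] meeting
    [W] as little as dimensions permit, and adding it raises the dimension of
    [W] by [d], or up to [n] if less than [d] is left.  Hence [m] well chosen
    translates have a sum of dimension [minn n (m * d)]
    ([transversal_sum_dim]).  No [m] translates do better, so [m] translates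
    can span [V] exactly when [n <= m * d] ([transversal_translates_spanP]), and
    the least such [m] is the ceiling of [n / d] ([least_cover_ceil]).

    Irreducibility ensures that [V], hence some [U], is nonzero, and that some
    number of translates of a nonzero [U] spans [V]. *)

Set Implicit Arguments.
Unset Strict Implicit.
Unset Printing Implicit Defensive.

Local Open Scope classical_set_scope.
Local Open Scope ring_scope.

Import Order.TTheory GRing.Theory Num.Theory.

Lemma least_cover_ceil (n d D : nat) :
  (0 < d)%N -> (n <= D * d)%N -> (forall m, (n <= m * d)%N -> (D <= m)%N) ->
  Num.ceil (n%:R / d%:R : rat) = D%:Z.
Proof.
move=> d_gt0 nD minD.
have ceil_leE (m : nat) : (Num.ceil (n%:R / d%:R : rat) <= m%:Z) = (n <= m * d)%N.
  by rewrite ceil_le_int ler_pdivrMr ?ltr0n// -natrM ler_nat.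
apply/le_anti; rewrite ceil_leE nD /=.
have: 0 <= Num.ceil (n%:R / d%:R : rat).
  by rewrite -(ceil0 rat) le_ceil// divr_ge0 ?ler0n.
case: (Num.ceil _) ceil_leE => // c le_c _.
by rewrite lez_nat minD// -le_c.
Qed.

Section TransversalAction.
Variables (F : fieldType) (V : vectType F) (H : groupType).
Variable rho : H -> 'End(V).
Hypothesis rho_lin : is_linear_action rho.

Lemma dim_translate (g : H) (U : {vspace V}) : \dim (rho g @: U) = \dim U.
Proof.
have [rho1 rhoM] := rho_lin.
apply/limg_dim_eq/eqP; rewrite -subv0; apply/subvP=> v /memv_capP[_].
rewrite memv_ker memv0 => /eqP gv0.
by rewrite -[v]id_lfunE -rho1 -(mulVg g) rhoM comp_lfunE gv0 linear0.
Qed.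

Lemma translates_span_dim_le (U : {vspace V}) (m : nat) :
  translates_span rho U m -> (\dim {:V} <= m * \dim U)%N.
Proof.
move=> [g <-]. apply: leq_trans (dimv_leq_sum _ _ _) _.
under eq_bigr do rewrite dim_translate.
by rewrite sum_nat_const card_ord.
Qed.

Hypothesis rho_trans : transversal_action rho.

(** The family is indexed by [nat] rather than by ['I_m], so that it can be
    prolonged by one translate without reindexing. *)
Lemma transversal_sum_dim (U : {vspace V}) (m : nat) :
  exists g : nat -> H,
    \dim (\sum_(i < m) rho (g i) @: U)%VS = minn (\dim {:V}) (m * \dim U).
Proof.
elim: m => [|m [g dim_g]].
  by exists (fun=> 1%g); rewrite big_ord0 dimv0 mul0n minn0.
have [h dim_h] := rho_trans (\sum_(i < m) rho (g i) @: U)%VS U.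
exists (fun i => if (i < m)%N then g i else h).
rewrite big_ord_recr /= ltnn.
under eq_bigr => i _ do rewrite ltn_ord.
have := dimv_sum_cap (\sum_(i < m) rho (g i) @: U)%VS (rho h @: U)%VS.
rewrite dim_h dim_translate dim_g mulSn.
set s := \dim (_ + _)%VS; have := dimvS (subvf U).
lia.
Qed.

Lemma transversal_translates_spanP (U : {vspace V}) (m : nat) :
  translates_span rho U m <-> (\dim {:V} <= m * \dim U)%N.
Proof.
split; first exact: translates_span_dim_le.
move=> le_n; have [g dim_g] := transversal_sum_dim U m.
exists (fun i => g i); apply/eqP.
by rewrite eqEdim subvf dim_g (minn_idPl le_n) leqnn.
Qed.

Lemma transversal_covering_ratio (U : {vspace V}) :
  irreducible_action rho -> U <> 0%VS -> covering_ratio rho U = 1.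
Proof.
move=> rho_irr U0; have [spanD minD] := diam_plusP rho_lin rho_irr U0.
have V_gt0 : (0 < \dim {:V})%N.
  by rewrite lt0n dimv_eq0; apply/eqP; case: rho_irr.
have U_gt0 : (0 < \dim U)%N by rewrite lt0n dimv_eq0; apply/eqP.
have le_nD := translates_span_dim_le spanD.
rewrite /covering_ratio (least_cover_ceil U_gt0 le_nD) => [|m le_n].
  by rewrite divff// pnatr_eq0; lia.
exact/minD/transversal_translates_spanP.
Qed.

Lemma transversal_covering_complexity :
  irreducible_action rho -> covering_complexity rho = 1.
Proof.
move=> rho_irr; have ratio1 U := @transversal_covering_ratio U rho_irr.
rewrite /covering_complexity; case: xgetP => [c -> [[U U0 <-] _]|no_max].
  exact: ratio1.
have V0 := rho_irr.1.
case: (no_max 1); split; first by exists fullv => //; exact: ratio1.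
by move=> U /ratio1->.
Qed.

End TransversalAction.

Theorem proposition4p1 (R : realType) (K : topologicalGroupType)
  (V : vectType R[i]) (dot : {dot V for Num.conj}) (rho : K -> 'End(V)) :
  compact [set: K] ->
  is_linear_action rho ->
  continuous_action rho ->
  unitary_action dot rho ->
  irreducible_action rho ->
  transversal_action rho ->
  covering_complexity rho = 1.
Proof.
move=> _ rho_lin _ _ rho_irr rho_trans.
exact: transversal_covering_complexity.
Qed.
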